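(* Let $\gamma_1,\gamma_2$ be constants, each real or purely imaginary. On $T^*\mathbb{R}^2$ with canonical coordinates $(q_1,q_2,p_1,p_2)$ let $$H_{(2)}=p_1^2+p_2^2+\gamma_1(q_1p_1+q_2p_2)+\gamma_2(q_1p_1+q_2p_2)^2,\qquad I_1=\bigl(1+\gamma_2(q_1^2+q_2^2)\bigr)p_1^2+\gamma_1q_1p_1,$$ and $$K_{I_1}=\begin{pmatrix}1+\gamma_2q_2^2&-\gamma_2q_1q_2&0&0\\0&0&0&0\\0&\gamma_2q_2p_1&1+\gamma_2q_2^2&0\\-\gamma_2q_2p_1&0&-\gamma_2q_1q_2&0\end{pmatrix}.$$ 1. $K_{I_1}$ is a semisimple Haantjes operator for the pair $(H_{(2)},I_1)$: it is compatible with $\omega=dq_1\wedge dp_1+dq_2\wedge dp_2$ and satisfies the chain equation $K_{I_1}^T\,dH_{(2)}=dI_1$. Its eigenvalues are $1+\gamma_2q_2^2$ and $0$, both double. The operator $\mathcal N_{I_1}=K_{I_1}-\tfrac12\operatorname{tr}(K_{I_1})\,I$ is a Nijenhuis operator, with eigenvalues $0$ and $-(1+\gamma_2q_2^2)$. 2. Darboux--Haantjes coordinates for the pair $(H_{(2)},I_1)$ are given by $$Q_1=\frac{q_1}{\sqrt{1+\gamma_2q_2^2}},\quad P_1=p_1\sqrt{1+\gamma_2q_2^2},\quad Q_2=q_2,\quad P_2=p_2+\frac{\gamma_2q_1q_2p_1}{1+\gamma_2q_2^2};$$ this transformation is canonical and reduces to the identity in the limit $\gamma_2\to0$. 3. In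 these coordinates $$I_1=P_1^2+\gamma_1Q_1P_1+\gamma_2(Q_1P_1)^2,$$ $$H_{(2)}=\frac{P_1^2+\gamma_1Q_1P_1+\gamma_2(Q_1P_1)^2}{1+\gamma_2Q_2^2}+P_2^2+\gamma_1Q_2P_2+\gamma_2(Q_2P_2)^2.$$
   Context: Matrices of operators are written with respect to the frame $\partial_{q_1},\partial_{q_2},\partial_{p_1},\partial_{p_2}$. For a $(1,1)$ tensor field $L$, the Nijenhuis torsion is $T_L(X,Y)=L^2[X,Y]+[LX,LY]-L([X,LY]+[LX,Y])$ and the Haantjes torsion is $\mathcal H_L(X,Y)=L^2T_L(X,Y)+T_L(LX,LY)-L(T_L(X,LY)+T_L(LX,Y))$. $L$ is a Nijenhuis (respectively Haantjes) operator if $T_L\equiv0$ (respectively $\mathcal H_L\equiv0$). Compatibility with $\omega$: $\Omega K=K^T\Omega$, where $\omega(X,Y)=\langle\Omega X,Y\rangle$. Semisimple: algebraic and geometric multiplicity coincide for every eigenvalue. Darboux--Haantjes coordinates: coordinates in which $\omega=\sum_i dQ_i\wedge dP_i$ and the Haantjes operator is diagonal; they are separation variables for the Hamilton--Jacobi equation. Canonical: $\{Q_i,Q_j\}=\{P_i,P_j\}=0$, $\{Q_i,P_j\}=\delta_{ij}$.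
   Formalization: Semisimplicity, ''both double'' and all coordinate claims except the limit γ₂→0 are stated only where 1+γ₂q₂²≠0; where it vanishes (possible for real γ₂<0) the eigenvalues coincide, K_{I_1} is in general a nonzero nilpotent, and the coordinates Q₁, P₂ are undefined. *)

(* Defs.v *)
From HB Require Import structures.
From mathcomp Require Import all_boot all_order all_algebra.
From mathcomp Require Import all_classical all_reals all_analysis.
From mathcomp Require Import complex.
Set Implicit Arguments. Unset Strict Implicit. Unset Printing Implicit Defensive.
Import Order.TTheory GRing.Theory Num.Theory numFieldNormedType.Exports.
Local Open Scope classical_set_scope.
Local Open Scope ring_scope.
Local Open Scope complex_scope.

(* Points of T^*R^2 are row vectors (q1, q2, p1, p2).  The parameters may be
   purely imaginary, so functions, vector fields and operators on T^*R^2 take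
   complex values; tangent vectors and covectors are columns over R[i]. *)
Notation phase R := 'rV[R]_4.

Definition qidx (i : 'I_2) : 'I_4 := lshift 2 i.
Definition pidx (i : 'I_2) : 'I_4 := rshift 2 i.

Section Calculus.
Variable R : realType.
Implicit Types (f g : phase R -> R[i]) (X Y : phase R -> 'cV[R[i]]_4).
Implicit Types (L : phase R -> 'M[R[i]]_4).

Definition partial (j : 'I_4) f (x : phase R) : R[i] :=
  ('D_(delta_mx 0 j) (fun y => complex.Re (f y)) x)
  +i* ('D_(delta_mx 0 j) (fun y => complex.Im (f y)) x).

(* C^oo on the open set U: every iterated partial derivative is
   (Fréchet) differentiable at every point of U. *)
Definition smooth_on (U : set (phase R)) f : Prop :=
  forall (s : seq 'I_4) (x : phase R), U x ->
    differentiable (fun y => complex.Re (foldr partial f s y)) x /\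
    differentiable (fun y => complex.Im (foldr partial f s y)) x.

Definition smooth_field X : Prop :=
  forall i, smooth_on setT (fun x => X x i 0).

Definition d f (x : phase R) : 'cV[R[i]]_4 := \col_j partial j f x.

Definition field_jacobian X (x : phase R) : 'M[R[i]]_4 :=
  \matrix_(i, j) partial j (fun y => X y i 0) x.

Definition bracket X Y (x : phase R) : 'cV[R[i]]_4 :=
  field_jacobian Y x *m X x - field_jacobian X x *m Y x.

Definition appl L X : phase R -> 'cV[R[i]]_4 := fun x => L x *m X x.

Definition Nijenhuis_torsion L X Y : phase R -> 'cV[R[i]]_4 := fun x =>
  appl L (appl L (bracket X Y)) x + bracket (appl L X) (appl L Y) x
  - L x *m (bracket X (appl L Y) x + bracket (appl L X) Y x).

Definition Haantjes_torsion L X Y : phase R -> 'cV[R[i]]_4 := fun x =>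
  let T := Nijenhuis_torsion L in
  appl L (appl L (T X Y)) x + T (appl L X) (appl L Y) x
  - L x *m (T X (appl L Y) x + T (appl L X) Y x).

Definition Nijenhuis_operator L : Prop :=
  forall X Y, smooth_field X -> smooth_field Y ->
    forall x, Nijenhuis_torsion L X Y x = 0.

Definition Haantjes_operator L : Prop :=
  forall X Y, smooth_field X -> smooth_field Y ->
    forall x, Haantjes_torsion L X Y x = 0.

Definition q (i : 'I_2) (x : phase R) : R[i] := (x 0 (qidx i))%:C.
Definition p (i : 'I_2) (x : phase R) : R[i] := (x 0 (pidx i))%:C.

Definition wedge (a b X Y : 'cV[R[i]]_4) : R[i] :=
  (a^T *m X) 0 0 * (b^T *m Y) 0 0 - (a^T *m Y) 0 0 * (b^T *m X) 0 0.

(* \sum_i dQ_i /\ dP_i at x *)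
Definition sum_dQdP (Q P : 'I_2 -> phase R -> R[i]) (x : phase R)
    (X Y : 'cV[R[i]]_4) : R[i] :=
  \sum_i wedge (d (Q i) x) (d (P i) x) X Y.

Definition omega := sum_dQdP q p.

(* omega(X, Y) = (Omega X)^T Y *)
Definition Omega (x : phase R) : 'M[R[i]]_4 :=
  \matrix_(i, j) omega x (delta_mx j 0) (delta_mx i 0).

Definition compatible_omega L : Prop :=
  forall x, Omega x *m L x = (L x)^T *m Omega x.

Definition chain_equation L (H I : phase R -> R[i]) : Prop :=
  forall x, (L x)^T *m d H x = d I x.

Definition poisson f g (x : phase R) : R[i] :=
  \sum_(i < 2) (partial (qidx i) f x * partial (pidx i) g x
                - partial (pidx i) f x * partial (qidx i) g x).

Definition canonical_on (U : set (phase R)) (Q P : 'I_2 -> phase R -> R[i]) :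
    Prop :=
  forall x, U x -> forall i j,
    [/\ poisson (Q i) (Q j) x = 0, poisson (P i) (P j) x = 0
      & poisson (Q i) (P j) x = (i == j)%:R].

(* The components in the order Q1, Q2, P1, P2. *)
Definition components (Q P : 'I_2 -> phase R -> R[i]) (a : 'I_4) :
    phase R -> R[i] :=
  match @fintype.split 2%N 2%N a with inl i => Q i | inr i => P i end.

Definition coord_jacobian (Q P : 'I_2 -> phase R -> R[i]) (x : phase R) :
    'M[R[i]]_4 :=
  \matrix_(a, j) partial j (components Q P a) x.

(* Possibly complex-valued coordinates on the open set U.  When the four
   functions are real-valued, this is a chart of U in the usual sense, by the
   inverse function theorem. *)
Definition coordinates_on (U : set (phase R)) (Q P : 'I_2 -> phase R -> R[i]) :
    Prop :=
  [/\ forall a, smooth_on U (components Q P a),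
      forall x y, U x -> U y ->
        (forall a, components Q P a x = components Q P a y) -> x = y
    & forall x, U x -> coord_jacobian Q P x \in unitmx].

(* The last clause says that the matrix of L in the frame of the new
   coordinates is diagonal. *)
Definition Darboux_Haantjes_on (U : set (phase R)) L
    (Q P : 'I_2 -> phase R -> R[i]) : Prop :=
  [/\ coordinates_on U Q P,
      forall x, U x -> forall X Y : 'cV[R[i]]_4, omega x X Y = sum_dQdP Q P x X Y
    & forall x, U x ->
        is_diag_mx (coord_jacobian Q P x *m L x *m
                    invmx (coord_jacobian Q P x))].

End Calculus.

Section Spectrum.
Variables (F : fieldType) (n : nat).
Implicit Types (A : 'M[F]_n) (a : F).

Definition alg_mult A a : nat := mup a (char_poly A).

(* eigenspace is about row eigenvectors, hence the transpose. *)
Definition geo_mult A a : nat := \rank (eigenspace A^T a).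

Definition semisimple A : Prop :=
  forall a, eigenvalue A a -> alg_mult A a = geo_mult A a.

End Spectrum.

Section System.
Variables (R : realType) (g1 g2 : R[i]).
Implicit Types x : phase R.

Definition real_or_imaginary (g : R[i]) : Prop :=
  complex.Im g = 0 \/ complex.Re g = 0.

Definition q1 x : R[i] := q 0 x.
Definition q2 x : R[i] := q 1 x.
Definition p1 x : R[i] := p 0 x.
Definition p2 x : R[i] := p 1 x.

Definition H2 x : R[i] :=
  p1 x ^+ 2 + p2 x ^+ 2 + g1 * (q1 x * p1 x + q2 x * p2 x)
  + g2 * (q1 x * p1 x + q2 x * p2 x) ^+ 2.

Definition I1 x : R[i] :=
  (1 + g2 * (q1 x ^+ 2 + q2 x ^+ 2)) * p1 x ^+ 2 + g1 * q1 x * p1 x.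

Definition lam x : R[i] := 1 + g2 * q2 x ^+ 2.

(* The open set where lam does not vanish; it is the whole phase space unless
   g2 is real and negative.  Where lam = 0 the new coordinates are undefined,
   and K_I1 is nilpotent, nonzero unless q1 = p1 = 0. *)
Definition dom : set (phase R) := [set x | lam x != 0].

Definition mx_of_rows (s : seq (seq R[i])) : 'M[R[i]]_4 :=
  \matrix_(i, j) nth 0 (nth [::] s i) j.

Definition K_I1 x : 'M[R[i]]_4 := mx_of_rows
  [:: [:: 1 + g2 * q2 x ^+ 2; - (g2 * q1 x * q2 x); 0; 0];
      [:: 0; 0; 0; 0];
      [:: 0; g2 * q2 x * p1 x; 1 + g2 * q2 x ^+ 2; 0];
      [:: - (g2 * q2 x * p1 x); 0; - (g2 * q1 x * q2 x); 0]].

Definition N_I1 x : 'M[R[i]]_4 := K_I1 x - (2^-1 * \tr (K_I1 x))%:M.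

(* sqrtc is the principal branch.  It is smooth in x on dom: lam has real
   part 1 if g2 is purely imaginary, and is real if g2 is. *)
Definition Q1 x : R[i] := q1 x / sqrtc (lam x).
Definition P1 x : R[i] := p1 x * sqrtc (lam x).
Definition Q2 x : R[i] := q2 x.
Definition P2 x : R[i] := p2 x + g2 * q1 x * q2 x * p1 x / lam x.

Definition Qs (i : 'I_2) : phase R -> R[i] := if i == 0 then Q1 else Q2.
Definition Ps (i : 'I_2) : phase R -> R[i] := if i == 0 then P1 else P2.

End System.

(* Main.v *)
(* The Nijenhuis torsion is a tensor, so both torsions are evaluated pointwise
   from the first derivatives of the entries of the operator; the torsion of
   K := K_I1 turns out to be 2 g2 q2 K w with w = (s, 0, t, 0), where s and t
   vanish as soon as both arguments lie in the image of K.  With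
   rt = sqrt lam, the Jacobian J of the new coordinates is symplectic and
   satisfies J K = diag(lam, 0, lam, 0) J; this gives the Darboux-Haantjes
   property and, since ranks are invariant under conjugation, semisimplicity.
   The only delicate analytic point is the smoothness of rt: for imaginary g2,
   lam has real part 1 and stays off the branch cut, while for real g2 it stays
   real and of locally constant sign. *)
Require Import Defs.
From HB Require Import structures.
From mathcomp Require Import all_boot all_order all_algebra.
From mathcomp Require Import all_classical all_reals all_analysis.
From mathcomp Require Import zify complex ring.
Set Implicit Arguments. Unset Strict Implicit. Unset Printing Implicit Defensive.
Import Order.TTheory GRing.Theory Num.Theory numFieldNormedType.Exports.
Local Open Scope classical_set_scope.
Local Open Scope ring_scope.

(** * Calculus of complex-valued functions *)

(** Differentiability depends only on the germ: the first-order expansion of [f] at [x] is also one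
    of [g], and such an expansion determines the differential. *)
Lemma near_differentiable {K : realFieldType} {V W : normedModType K}
    (f g : V -> W) (x : V) :
  (\forall y \near x, f y = g y) -> differentiable f x -> differentiable g x.
Proof.
move=> fg fx; have fgx : f x = g x by exact: nbhs_singleton fg.
have [dc /eqaddoP fE] := (diff_locallyP x f).1 fx.
have gE : g \o shift x = cst (g x) + 'd f x +o_ (0 : V) id.
  apply/eqaddoP => e e0.
  have fgs : \forall y \near (0 : V), f (y + x) = g (y + x).
    by move/nbhs0P: fg; apply: filterS => y; rewrite addrC.
  move: (fE e e0); apply: filterS2 fgs => y fgy.
  by rewrite !fctE /= fgy fgx.
have dE : 'd g x = 'd f x :> (V -> W) by exact: diff_unique.
by apply/diff_locallyP; rewrite dE.
Qed.

Section ComplexCalculus.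
Context {R : realType}.
Local Notation Re := complex.Re.
Local Notation Im := complex.Im.
Implicit Types (f g : phase R -> R[i]) (x y : phase R) (D : 'I_4 -> R[i]).

Lemma complexReD (a b : R[i]) : Re (a + b) = Re a + Re b.
Proof. by case: a => ? ?; case: b. Qed.

Lemma complexImD (a b : R[i]) : Im (a + b) = Im a + Im b.
Proof. by case: a => ? ?; case: b. Qed.

Lemma complexReM (a b : R[i]) : Re (a * b) = Re a * Re b - Im a * Im b.
Proof. by case: a => ? ?; case: b. Qed.

Lemma complexImM (a b : R[i]) : Im (a * b) = Re a * Im b + Im a * Re b.
Proof. by case: a => ? ?; case: b. Qed.

Lemma complexReV (a : R[i]) : Re a^-1 = Re a / (Re a ^+ 2 + Im a ^+ 2).
Proof. by case: a. Qed.

Lemma complexImV (a : R[i]) : Im a^-1 = - (Im a / (Re a ^+ 2 + Im a ^+ 2)).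
Proof. by case: a. Qed.

Lemma complex_neq0 (a : R[i]) : (a != 0) = (Re a != 0) || (Im a != 0).
Proof. by case: a => u v; rewrite eq_complex /= negb_and. Qed.

Lemma sqr_norm_gt0 (a : R[i]) : a != 0 -> 0 < Re a ^+ 2 + Im a ^+ 2.
Proof.
rewrite complex_neq0 => /orP[] h.
  by rewrite ltr_pwDl ?sqr_ge0 // exprn_even_gt0.
by rewrite ltr_wpDl ?sqr_ge0 // exprn_even_gt0.
Qed.

Definition cdiff f x :=
  differentiable (fun y => Re (f y)) x /\ differentiable (fun y => Im (f y)) x.

(** Bundles differentiability with the values of the partial derivatives, so that the rules below
    compose as proof terms that compute gradients. Only real differentiability is meant, not
    holomorphy. *)
Definition cderiv f x D := cdiff f x /\ forall j, partial j f x = D j.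

Lemma cderivP f x : cdiff f x -> cderiv f x (fun j => partial j f x).
Proof. by []. Qed.

Lemma eq_cderiv f x D D' : cderiv f x D -> D =1 D' -> cderiv f x D'.
Proof. by move=> [fx fD] DD'; split=> // j; rewrite fD. Qed.

Lemma near_partial j f g x :
  (\forall y \near x, f y = g y) -> partial j f x = partial j g x.
Proof.
by move=> fg; congr (_ +i* _)%C; apply: near_eq_derive; move: fg;
  apply: filterS => y ->.
Qed.

Lemma near_cdiff f g x :
  (\forall y \near x, f y = g y) -> cdiff f x -> cdiff g x.
Proof.
by move=> fg [fr fi]; split; [move: fr|move: fi]; apply: near_differentiable;
  move: fg; apply: filterS => y ->.
Qed.

Lemma cderiv_cst (c : R[i]) x : cderiv (fun=> c) x (fun=> 0).
Proof.
split=> [|j]; last by rewrite /partial !derive_cst.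
by split; exact: differentiable_cst.
Qed.

Lemma derive_coord (k j : 'I_4) x :
  'D_(delta_mx 0 j) (fun y : phase R => y 0 k) x = (j == k)%:R.
Proof.
apply/cvg_lim => //; apply: cvg_near_cst.
(* The difference quotient of a coordinate is the same for every [t != 0], so any radius will do. *)
exists 1 => //= t _ t0; rewrite !mxE addrK /= /GRing.scale /=.
by rewrite mulrA mulVf // mul1r eq_sym.
Qed.

Lemma cderiv_coord (k : 'I_4) x :
  cderiv (fun y => (y 0 k)%:C%C) x (fun j => (j == k)%:R).
Proof.
split=> [|j].
  by split; [exact: differentiable_coord|exact: differentiable_cst].
by rewrite /partial derive_coord derive_cst; case: eqP.
Qed.

Lemma cderivD {f g x D D'} : cderiv f x D -> cderiv g x D' ->
  cderiv (fun y => f y + g y) x (fun j => D j + D' j).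
Proof.
move=> [[fr fi] fD] [[gr gi] gD].
have ReE : (fun y => Re (f y + g y)) =
    (fun y => Re (f y)) + (fun y => Re (g y)).
  by apply/funext => y; rewrite complexReD.
have ImE : (fun y => Im (f y + g y)) =
    (fun y => Im (f y)) + (fun y => Im (g y)).
  by apply/funext => y; rewrite complexImD.
split=> [|j]; rewrite /cdiff /partial ReE ImE.
  by split; exact: differentiableD.
by rewrite -fD -gD /partial !deriveD //; exact: diff_derivable.
Qed.

Lemma cderivM {f g x D D'} : cderiv f x D -> cderiv g x D' ->
  cderiv (fun y => f y * g y) x (fun j => D j * g x + f x * D' j).
Proof.
move=> [[fr fi] fD] [[gr gi] gD].
have ReE : (fun y => Re (f y * g y)) =
    (fun y => Re (f y)) * (fun y => Re (g y)) -
    (fun y => Im (f y)) * (fun y => Im (g y)).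
  by apply/funext => y; rewrite complexReM.
have ImE : (fun y => Im (f y * g y)) =
    (fun y => Re (f y)) * (fun y => Im (g y)) +
    (fun y => Im (f y)) * (fun y => Re (g y)).
  by apply/funext => y; rewrite complexImM.
split=> [|j]; rewrite /cdiff /partial ReE ImE.
  by split; [apply: differentiableB|apply: differentiableD];
     exact: differentiableM.
have dv (h : phase R -> R) :
    differentiable h x -> derivable h x (delta_mx 0 j : phase R).
  exact: diff_derivable.
have dM (h k : phase R -> R) : differentiable h x -> differentiable k x ->
    derivable (h * k) x (delta_mx 0 j : phase R).
  by move=> hx kx; apply: dv; exact: differentiableM.
have DM (h k : phase R -> R) : differentiable h x -> differentiable k x ->
    'D_(delta_mx 0 j) (h * k) x = h x * 'D_(delta_mx 0 j) k x
      + k x * 'D_(delta_mx 0 j) h x.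
  by move=> hx kx; rewrite deriveM //; exact: dv.
rewrite -fD -gD /partial (deriveB (dM _ _ fr gr) (dM _ _ fi gi)).
rewrite (deriveD (dM _ _ fr gi) (dM _ _ fi gr)) !DM //.
move: ('D__ (fun y => Re (f y)) x) ('D__ (fun y => Im (f y)) x) => f1 f2.
move: ('D__ (fun y => Re (g y)) x) ('D__ (fun y => Im (g y)) x) => g1 g2.
case: (f x) => a b; case: (g x) => a' b'.
apply/eqP; rewrite eq_complex /=.
by apply/andP; split; apply/eqP; ring.
Qed.

Lemma cderivZ {f x D} (c : R[i]) : cderiv f x D ->
  cderiv (fun y => c * f y) x (fun j => c * D j).
Proof.
move=> fx; apply: (eq_cderiv (cderivM (cderiv_cst c x) fx)) => j.
by rewrite mul0r add0r.
Qed.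

Lemma cderivN {f x D} : cderiv f x D ->
  cderiv (fun y => - f y) x (fun j => - D j).
Proof.
move=> fx; rewrite (_ : (fun y => - f y) = (fun y => (-1) * f y)).
  by apply: (eq_cderiv (cderivZ (-1) fx)) => j; rewrite mulN1r.
by apply/funext => y; rewrite mulN1r.
Qed.

Lemma cdiff_near_neq0 f x :
  cdiff f x -> f x != 0 -> \forall y \near x, f y != 0.
Proof.
move=> [/differentiable_continuous fr /differentiable_continuous fi].
rewrite complex_neq0 => /orP[] h.
  have H : nbhs (Re (f x)) [set r | r != 0].
    by apply: open_nbhs_nbhs; split=> //; exact: open_neq.
  have : \forall y \near x, Re (f y) != 0 by exact: fr _ H.
  by apply: filterS => y fy; rewrite complex_neq0 fy.
have H : nbhs (Im (f x)) [set r | r != 0].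
  by apply: open_nbhs_nbhs; split=> //; exact: open_neq.
have : \forall y \near x, Im (f y) != 0 by exact: fi _ H.
by apply: filterS => y fy; rewrite complex_neq0 fy orbT.
Qed.

(** Differentiability is read off the real formulas for the parts of the inverse. The values of the
    partial derivatives then come from differentiating the product [f * f^-1], which is constant
    near [x]. *)
Lemma cderivV {f x D} : f x != 0 -> cderiv f x D ->
  cderiv (fun y => (f y)^-1) x (fun j => - D j / f x ^+ 2).
Proof.
move=> fx0 [fx fD].
have Vx : cdiff (fun y => (f y)^-1) x.
  have [fr fi] := fx; have n0 := lt0r_neq0 (sqr_norm_gt0 fx0).
  have dn : differentiable
      (fun y => (Re (f y) ^+ 2 + Im (f y) ^+ 2)^-1) x.
    by apply: differentiableV => //; apply: differentiableD;
       under eq_fun do rewrite expr2; exact: differentiableM.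
  split.
    under eq_fun do rewrite complexReV.
    exact: differentiableM.
  under eq_fun do rewrite complexImV.
  by apply: differentiableN; exact: differentiableM.
split=> // j.
have [_ /(_ j) M] := cderivM (conj fx fD) (cderivP Vx).
have : partial j (fun y => f y * (f y)^-1) x = 0.
  rewrite (_ : partial _ _ _ = partial j (fun=> 1) x).
    by have [_ ->] := cderiv_cst 1 x.
  apply: near_partial; move: (cdiff_near_neq0 fx fx0).
  by apply: filterS => y fy; rewrite divff.
rewrite M => /eqP; rewrite addr_eq0 => /eqP E.
apply: (mulfI fx0); rewrite -[LHS]opprK -E.
by field.
Qed.

End ComplexCalculus.

(** * Differentiability of the principal square root *)

Section SquareRoot.
Context {R : realType}.
Local Notation Re := complex.Re.
Local Notation Im := complex.Im.
Implicit Types (f g : phase R -> R[i]) (x y : phase R) (D : 'I_4 -> R[i]).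
Implicit Type z : R[i].

(** The plane cut along the nonpositive real axis, where the principal square root is analytic. *)
Definition slit_plane : pred R[i] := fun z => (Im z != 0) || (0 < Re z).

Lemma slit_plane_neq0 z : slit_plane z -> z != 0.
Proof.
rewrite complex_neq0 => /orP[->|/gt_eqF/negbT->] //; exact: orbT.
Qed.

(** This quantity is twice the square of [Re (sqrtc z)]. If [Im z != 0] then |Re z| < |z|; otherwise
    [Re z] is itself positive. *)
Lemma slit_plane_sum_gt0 z : slit_plane z ->
  0 < Num.sqrt (Re z ^+ 2 + Im z ^+ 2) + Re z.
Proof.
move=> zs; have z0 := sqr_norm_gt0 (slit_plane_neq0 zs).
case/orP: zs => [im0|re0]; last by rewrite ltr_wpDl ?sqrtr_ge0.
rewrite -ltrBlDr sub0r; apply: le_lt_trans (ler_norm _) _; rewrite normrN.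
by rewrite -sqrtr_sqr ltr_sqrt // ltrDl exprn_even_gt0.
Qed.

Lemma Re_sqrtc z :
  Re (sqrtc z) = Num.sqrt ((Num.sqrt (Re z ^+ 2 + Im z ^+ 2) + Re z) / 2).
Proof. by case: z. Qed.

(** Comes from the imaginary part of [sqrtc z ^+ 2 = z]. It replaces the case distinction on the
    sign of [Im z] in the definition of [sqrtc] by a quotient that can be differentiated. *)
Lemma slit_plane_Im_sqrtc z : slit_plane z ->
  Im (sqrtc z) = Im z / (2 * Re (sqrtc z)).
Proof.
move=> /slit_plane_sum_gt0 z0.
have r0 : Re (sqrtc z) != 0.
  by rewrite Re_sqrtc gt_eqF // sqrtr_gt0 divr_gt0.
have -> : Im z = 2 * Re (sqrtc z) * Im (sqrtc z).
  by rewrite -{1}[z]sqr_sqrtc expr2 complexImM; ring.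
by field.
Qed.

Lemma sqrtc_neg z : Im z = 0 -> Re z < 0 ->
  sqrtc z = (0 +i* Num.sqrt (- Re z))%C.
Proof.
case: z => a b /= -> a0; rewrite eqxx mul1r expr0n /= addr0 sqrtr_sqr.
rewrite ltr0_norm // addNr mul0r sqrtr0; congr (_ +i* Num.sqrt _)%C.
by field.
Qed.

Lemma differentiable_sqrt {V : normedModType R} (h : V -> R) (v : V) :
  0 < h v -> differentiable h v ->
  differentiable (fun u => Num.sqrt (h u)) v.
Proof.
move=> hv dh; apply: (differentiable_comp dh); apply/derivable1_diffP.
by have [] := is_derive1_sqrt hv.
Qed.

Lemma cdiff_sqrtc_slit_plane f x : (\forall y \near x, slit_plane (f y)) ->
  cdiff f x -> cdiff (fun y => sqrtc (f y)) x.
Proof.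
move=> fs [fr fi]; have fxs : slit_plane (f x) := nbhs_singleton fs.
have s0 := slit_plane_sum_gt0 fxs.
have dr : differentiable (fun y => Re (sqrtc (f y))) x.
  under eq_fun do rewrite Re_sqrtc.
  apply: differentiable_sqrt; first by rewrite divr_gt0.
  apply: differentiableM; last exact: differentiable_cst.
  apply: differentiableD => //; apply: differentiable_sqrt.
    exact/sqr_norm_gt0/slit_plane_neq0.
  by apply: differentiableD; under eq_fun do rewrite expr2;
     exact: differentiableM.
split=> //.
apply: (@near_differentiable _ _ _
  (fun y => Im (f y) / (2 * Re (sqrtc (f y))))).
  by move: fs; apply: filterS => y /slit_plane_Im_sqrtc ->.
apply: differentiableM => //; apply: differentiableV.
  by apply: differentiableM => //; exact: differentiable_cst.
by rewrite mulf_neq0 // Re_sqrtc gt_eqF // sqrtr_gt0 divr_gt0.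
Qed.

(** The values lie on the branch cut, but [f] never leaves it near [x]: there [sqrtc] is i times an
    ordinary real root. *)
Lemma cdiff_sqrtc_neg f x :
  (\forall y \near x, Im (f y) = 0 /\ Re (f y) < 0) ->
  cdiff f x -> cdiff (fun y => sqrtc (f y)) x.
Proof.
move=> fn [fr fi]; have [_ fx0] := nbhs_singleton fn.
apply: (@near_cdiff _ (fun y => (0 +i* Num.sqrt (- Re (f y)))%C)).
  by move: fn; apply: filterS => y [? ?]; rewrite sqrtc_neg.
split=> /=; first exact: differentiable_cst.
by apply: differentiable_sqrt; [rewrite oppr_gt0|exact: differentiableN].
Qed.

(** Once the root is known to be differentiable, differentiating its square, which is [f], gives the
    formula. *)
Lemma cderiv_sqrtc {f x D} : f x != 0 -> cderiv f x D ->
  cdiff (fun y => sqrtc (f y)) x ->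
  cderiv (fun y => sqrtc (f y)) x (fun j => D j / (2 * sqrtc (f x))).
Proof.
move=> fx0 [fx fD] sx; split=> // j.
have s0 : sqrtc (f x) != 0 by rewrite sqrtc_eq0.
have [_ /(_ j)] := cderivM (cderivP sx) (cderivP sx).
under [X in partial j X]eq_fun do rewrite -expr2 sqr_sqrtc.
rewrite fD => ->; field; exact: s0.
Qed.

End SquareRoot.

(** * Smooth functions on open sets *)

Section Smoothness.
Context {R : realType}.
Implicit Types (f g : phase R -> R[i]) (U : set (phase R)).

(* Coinduction: to show smoothness, exhibit a class of differentiable functions
   closed, up to equality on U, under partial derivatives. *)
Lemma smooth_on_coind U (C : (phase R -> R[i]) -> Prop) : open U ->
  (forall f, C f -> exists D : 'I_4 -> phase R -> R[i],
    (forall j, C (D j)) /\ forall x, U x -> cderiv f x (D^~ x)) ->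
  forall f, C f -> smooth_on U f.
Proof.
rewrite openE => Uo CD f Cf s.
(* An iterated partial derivative of [f] equals a member of [C] on [U] only; openness of [U] turns
   this into equality near each point, which differentiation respects. *)
suff [g Cg fg] : exists2 g, C g &
    forall x, U x -> foldr (@partial R) f s x = g x.
  move=> x Ux; have [D [_ /(_ x Ux)[gx _]]] := CD g Cg.
  apply: (near_cdiff _ gx); have := Uo x Ux.
  by apply: filterS => y Uy; rewrite fg.
elim: s => [|j s [g Cg fg]] /=; first by exists f.
have [D [CDj gD]] := CD g Cg; exists (D j) => // x Ux.
have [_ <-] := gD x Ux; apply: near_partial; have := Uo x Ux.
by apply: filterS => y Uy; rewrite fg.
Qed.

End Smoothness.

(** * Torsions as tensors *)

Section Torsion.
Context {R : realType}.
Implicit Types (f g : phase R -> R[i]) (x y : phase R) (D : 'I_4 -> R[i]).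
Implicit Types (X Y : phase R -> 'cV[R[i]]_4) (L : phase R -> 'M[R[i]]_4).

Lemma cderiv_sum {n} {F : 'I_n -> phase R -> R[i]} {x}
    {D : 'I_n -> 'I_4 -> R[i]} :
  (forall k, cderiv (F k) x (D k)) ->
  cderiv (fun y => \sum_k F k y) x (fun j => \sum_k D k j).
Proof.
move=> FD.
elim: (index_enum 'I_n) => [|k s IHs].
  under eq_fun do rewrite big_nil.
  by apply: (eq_cderiv (cderiv_cst 0 x)) => j; rewrite big_nil.
under eq_fun do rewrite big_cons.
by apply: (eq_cderiv (cderivD (FD k) IHs)) => j; rewrite big_cons.
Qed.

(** The Jacobian at [x] of the field [L u] with [u] held constant, for differentiable [L]. *)
Definition dmx L x (u : 'cV[R[i]]_4) : 'M[R[i]]_4 :=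
  \matrix_(i, j) \sum_k partial j (fun y => L y i k) x * u k 0.

(** The Nijenhuis torsion on the constant extensions of [u] and [v], whose own bracket vanishes. *)
Definition torsion_at L x (u v : 'cV[R[i]]_4) : 'cV[R[i]]_4 :=
  dmx L x v *m (L x *m u) - dmx L x u *m (L x *m v)
  + L x *m (dmx L x u *m v - dmx L x v *m u).

Section Tensor.
Variables (L : phase R -> 'M[R[i]]_4) (x : phase R).
Hypothesis dL : forall i j, cdiff (fun y => L y i j) x.

Definition cdiff_field X := forall i, cdiff (fun y => X y i 0) x.

Lemma cderiv_appl X i : cdiff_field X ->
  cderiv (fun y => appl L X y i 0) x
    (fun j => (dmx L x (X x) + L x *m field_jacobian X x) i j).
Proof.
move=> dX; under eq_fun do rewrite /appl mxE.
apply: (eq_cderiv (cderiv_sum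
  (fun k => cderivM (cderivP (dL i k)) (cderivP (dX k))))) => j.
by rewrite !mxE -big_split; apply: eq_bigr => k _; rewrite mxE.
Qed.

Lemma cdiff_appl X : cdiff_field X -> cdiff_field (appl L X).
Proof. by move=> dX i; have [] := cderiv_appl i dX. Qed.

Lemma field_jacobian_appl X : cdiff_field X ->
  field_jacobian (appl L X) x = dmx L x (X x) + L x *m field_jacobian X x.
Proof.
move=> dX; apply/matrixP => i j; rewrite mxE.
by have [_ ->] := cderiv_appl i dX.
Qed.

(* The torsion is a tensor: the derivatives of X and Y cancel. *)
Lemma Nijenhuis_torsionE X Y : cdiff_field X -> cdiff_field Y ->
  Nijenhuis_torsion L X Y x = torsion_at L x (X x) (Y x).
Proof.
move=> dX dY.
rewrite /Nijenhuis_torsion /bracket !field_jacobian_appl // /torsion_at /appl.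
move: (dmx L x (X x)) (dmx L x (Y x)) (field_jacobian X x)
  (field_jacobian Y x) => MX MY JX JY.
move: (L x) (X x) (Y x) => A u v.
rewrite !(mulmxDl, mulmxDr, mulmxN, mulNmx) -!mulmxA.
(* Each product becomes an atom, so that the cancellation of the terms in [JX] and [JY] is a linear
   identity in every entry. *)
move: (A *m (A *m (JY *m u))) (A *m (A *m (JX *m v))) (A *m (JY *m (A *m u)))
  (A *m (JX *m (A *m v))) (MY *m (A *m u)) (MX *m (A *m v)) (A *m (MX *m v))
  (A *m (MY *m u)) => t1 t2 t3 t4 t5 t6 t7 t8.
by apply/colP => i; rewrite !mxE; ring.
Qed.

Lemma Haantjes_torsionE X Y : cdiff_field X -> cdiff_field Y ->
  Haantjes_torsion L X Y x =
    L x *m (L x *m torsion_at L x (X x) (Y x))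
    + torsion_at L x (L x *m X x) (L x *m Y x)
    - L x *m (torsion_at L x (X x) (L x *m Y x)
              + torsion_at L x (L x *m X x) (Y x)).
Proof.
move=> dX dY; have dLX := cdiff_appl dX; have dLY := cdiff_appl dY.
by rewrite /Haantjes_torsion {1 2}/appl !Nijenhuis_torsionE.
Qed.

End Tensor.

Lemma smooth_field_cdiff X x : smooth_field X -> cdiff_field x X.
Proof. by move=> sX i; have := sX i [::] x I. Qed.

Lemma Nijenhuis_operatorP L : (forall x i j, cdiff (fun y => L y i j) x) ->
  (forall x u v, torsion_at L x u v = 0) -> Nijenhuis_operator L.
Proof.
move=> dL T0 X Y sX sY x.
by rewrite Nijenhuis_torsionE //; exact: smooth_field_cdiff.
Qed.

Lemma Haantjes_operatorP L : (forall x i j, cdiff (fun y => L y i j) x) ->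
  (forall x u v, L x *m (L x *m torsion_at L x u v)
    + torsion_at L x (L x *m u) (L x *m v)
    - L x *m (torsion_at L x u (L x *m v) + torsion_at L x (L x *m u) v) = 0) ->
  Haantjes_operator L.
Proof.
move=> dL H0 X Y sX sY x.
by rewrite Haantjes_torsionE //; exact: smooth_field_cdiff.
Qed.

End Torsion.

(** * Explicit computation with columns and matrices of size four *)

Section FourByFour.
Context {R : realType}.
Implicit Types a b c d : R[i].

Definition col4 a b c d : 'cV[R[i]]_4 := \col_i nth 0 [:: a; b; c; d] i.

Lemma forall_ord4 (P : 'I_4 -> Prop) :
  P 0 -> P 1 -> P 2%:R -> P 3%:R -> forall i, P i.
Proof.
move=> P0 P1 P2 P3 [[|[|[|[|//]]]] i4]; [move: P0|move: P1|move: P2|move: P3];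
  by congr P; exact: val_inj.
Qed.

Lemma sum_ord4 (F : 'I_4 -> R[i]) :
  \sum_i F i = F 0 + F 1 + F 2%:R + F 3%:R.
Proof.
rewrite !big_ord_recl big_ord0 addr0 !addrA.
by congr (F _ + F _ + F _ + F _); exact: val_inj.
Qed.

Lemma sum_ord2 (F : 'I_2 -> R[i]) : \sum_i F i = F 0 + F 1.
Proof.
by rewrite !big_ord_recl big_ord0 addr0; congr (F _ + F _); exact: val_inj.
Qed.

Lemma col4_eta (u : 'cV[R[i]]_4) :
  u = col4 (u 0 0) (u 1 0) (u 2%:R 0) (u 3%:R 0).
Proof. by apply/colP; apply: forall_ord4; rewrite mxE. Qed.

Lemma dot_col4 a b c d (u : 'cV[R[i]]_4) :
  ((col4 a b c d)^T *m u) 0 0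
  = a * u 0 0 + b * u 1 0 + c * u 2%:R 0 + d * u 3%:R 0.
Proof. by rewrite mxE sum_ord4 !mxE. Qed.

Lemma add_col4 a b c d a' b' c' d' :
  col4 a b c d + col4 a' b' c' d' = col4 (a + a') (b + b') (c + c') (d + d').
Proof. by apply/colP; apply: forall_ord4; rewrite !mxE. Qed.

Lemma opp_col4 a b c d : - col4 a b c d = col4 (- a) (- b) (- c) (- d).
Proof. by apply/colP; apply: forall_ord4; rewrite !mxE. Qed.

Lemma col4_0 a b c d : a = 0 -> b = 0 -> c = 0 -> d = 0 -> col4 a b c d = 0.
Proof.
by move=> -> -> -> ->; apply/colP; apply: forall_ord4; rewrite !mxE.
Qed.

Lemma mul_col4 a00 a01 a02 a03 a10 a11 a12 a13 a20 a21 a22 a23 a30 a31 a32 a33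
    a b c d :
  mx_of_rows [:: [:: a00; a01; a02; a03]; [:: a10; a11; a12; a13];
                 [:: a20; a21; a22; a23]; [:: a30; a31; a32; a33]]
    *m col4 a b c d =
  col4 (a00 * a + a01 * b + a02 * c + a03 * d)
       (a10 * a + a11 * b + a12 * c + a13 * d)
       (a20 * a + a21 * b + a22 * c + a23 * d)
       (a30 * a + a31 * b + a32 * c + a33 * d).
Proof. by apply/colP; apply: forall_ord4; rewrite !mxE sum_ord4 !mxE. Qed.

Lemma mul_mx4 a00 a01 a02 a03 a10 a11 a12 a13 a20 a21 a22 a23 a30 a31 a32 a33
    b00 b01 b02 b03 b10 b11 b12 b13 b20 b21 b22 b23 b30 b31 b32 b33 :
  mx_of_rows [:: [:: a00; a01; a02; a03]; [:: a10; a11; a12; a13];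
                 [:: a20; a21; a22; a23]; [:: a30; a31; a32; a33]]
  *m mx_of_rows [:: [:: b00; b01; b02; b03]; [:: b10; b11; b12; b13];
                 [:: b20; b21; b22; b23]; [:: b30; b31; b32; b33]] =
  let e p q r s t u v w : R[i] := p * t + q * u + r * v + s * w in
  mx_of_rows
   [:: [:: e a00 a01 a02 a03 b00 b10 b20 b30;
           e a00 a01 a02 a03 b01 b11 b21 b31;
           e a00 a01 a02 a03 b02 b12 b22 b32;
           e a00 a01 a02 a03 b03 b13 b23 b33];
       [:: e a10 a11 a12 a13 b00 b10 b20 b30;
           e a10 a11 a12 a13 b01 b11 b21 b31;
           e a10 a11 a12 a13 b02 b12 b22 b32;
           e a10 a11 a12 a13 b03 b13 b23 b33];
       [:: e a20 a21 a22 a23 b00 b10 b20 b30;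
           e a20 a21 a22 a23 b01 b11 b21 b31;
           e a20 a21 a22 a23 b02 b12 b22 b32;
           e a20 a21 a22 a23 b03 b13 b23 b33];
       [:: e a30 a31 a32 a33 b00 b10 b20 b30;
           e a30 a31 a32 a33 b01 b11 b21 b31;
           e a30 a31 a32 a33 b02 b12 b22 b32;
           e a30 a31 a32 a33 b03 b13 b23 b33]].
Proof.
by apply/matrixP; apply: forall_ord4; apply: forall_ord4;
  rewrite !mxE sum_ord4 !mxE.
Qed.

Lemma mx4_eta (A : 'M[R[i]]_4) : A = mx_of_rows
  [:: [:: A 0 0; A 0 1; A 0 2%:R; A 0 3%:R];
      [:: A 1 0; A 1 1; A 1 2%:R; A 1 3%:R];
      [:: A 2%:R 0; A 2%:R 1; A 2%:R 2%:R; A 2%:R 3%:R];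
      [:: A 3%:R 0; A 3%:R 1; A 3%:R 2%:R; A 3%:R 3%:R]].
Proof.
by apply/matrixP; apply: forall_ord4; apply: forall_ord4; rewrite mxE.
Qed.

End FourByFour.

(** * The operators K_I1 and N_I1 *)

Section Operator.
Context {R : realType}.
Variable g2 : R[i].
Implicit Types (x y : phase R).
Local Notation q1 := (@q1 R). Local Notation q2 := (@q2 R).
Local Notation p1 := (@p1 R). Local Notation p2 := (@p2 R).
Local Notation lam := (lam g2).

Definition grad4 (a b c d : R[i]) : 'I_4 -> R[i] :=
  fun j => nth 0 [:: a; b; c; d] j.

Lemma cderiv_q1 x : cderiv q1 x (grad4 1 0 0 0).
Proof. by apply: (eq_cderiv (cderiv_coord _ x)); apply: forall_ord4. Qed.

Lemma cderiv_q2 x : cderiv q2 x (grad4 0 1 0 0).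
Proof. by apply: (eq_cderiv (cderiv_coord _ x)); apply: forall_ord4. Qed.

Lemma cderiv_p1 x : cderiv p1 x (grad4 0 0 1 0).
Proof. by apply: (eq_cderiv (cderiv_coord _ x)); apply: forall_ord4. Qed.

Lemma cderiv_p2 x : cderiv p2 x (grad4 0 0 0 1).
Proof. by apply: (eq_cderiv (cderiv_coord _ x)); apply: forall_ord4. Qed.

Lemma cderiv_lam x : cderiv lam x (grad4 0 (2 * g2 * q2 x) 0 0).
Proof.
apply: (eq_cderiv (cderivD (cderiv_cst 1 x)
  (cderivZ g2 (cderivM (cderiv_q2 x) (cderiv_q2 x))))).
by apply: forall_ord4; rewrite /grad4 /=; ring.
Qed.

Lemma cderiv_q1q2 x :
  cderiv (fun y => - (g2 * q1 y * q2 y)) x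
    (grad4 (- (g2 * q2 x)) (- (g2 * q1 x)) 0 0).
Proof.
apply: (eq_cderiv (cderivN (cderivM (cderivZ g2 (cderiv_q1 x)) (cderiv_q2 x)))).
by apply: forall_ord4; rewrite /grad4 /=; ring.
Qed.

Lemma cderiv_q2p1 x :
  cderiv (fun y => g2 * q2 y * p1 y) x (grad4 0 (g2 * p1 x) (g2 * q2 x) 0).
Proof.
apply: (eq_cderiv (cderivM (cderivZ g2 (cderiv_q2 x)) (cderiv_p1 x))).
by apply: forall_ord4; rewrite /grad4 /=; ring.
Qed.

Definition grad_K x (i k : 'I_4) : 'I_4 -> R[i] :=
  let z := grad4 0 0 0 0 in
  let a := grad4 0 (2 * g2 * q2 x) 0 0 in
  let b := grad4 (- (g2 * q2 x)) (- (g2 * q1 x)) 0 0 in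
  let c := grad4 0 (g2 * p1 x) (g2 * q2 x) 0 in
  let c' := grad4 0 (- (g2 * p1 x)) (- (g2 * q2 x)) 0 in
  nth z (nth [::] [:: [:: a; b; z; z]; [:: z; z; z; z];
                      [:: z; c; a; z]; [:: c'; z; b; z]] i) k.

Lemma cderiv_K x i k : cderiv (fun y => K_I1 g2 y i k) x (grad_K x i k).
Proof.
have z0 : cderiv (fun=> 0) x (grad4 0 0 0 0).
  by apply: (eq_cderiv (cderiv_cst 0 x)); apply: forall_ord4.
have cN : cderiv (fun y => - (g2 * q2 y * p1 y)) x
    (grad4 0 (- (g2 * p1 x)) (- (g2 * q2 x)) 0).
  apply: (eq_cderiv (cderivN (cderiv_q2p1 x))).
  by apply: forall_ord4; rewrite /grad4 /= ?oppr0.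
have [a b c] := And3 (cderiv_lam x) (cderiv_q1q2 x) (cderiv_q2p1 x).
move: i k; apply: forall_ord4; apply: forall_ord4;
  by under eq_fun do rewrite mxE.
Qed.

Lemma tr_K x : \tr (K_I1 g2 x) = 2 * lam x.
Proof. by rewrite /mxtrace sum_ord4 !mxE /= /Defs.lam; ring. Qed.

Lemma N_I1_sub x : N_I1 g2 x = K_I1 g2 x - (lam x)%:M.
Proof. by rewrite /N_I1 tr_K mulKf ?pnatr_eq0. Qed.

Lemma N_I1E x : N_I1 g2 x = mx_of_rows
  [:: [:: 0; - (g2 * q1 x * q2 x); 0; 0];
      [:: 0; - lam x; 0; 0];
      [:: 0; g2 * q2 x * p1 x; 0; 0];
      [:: - (g2 * q2 x * p1 x); 0; - (g2 * q1 x * q2 x); - lam x]].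
Proof.
rewrite N_I1_sub.
by apply/matrixP; apply: forall_ord4; apply: forall_ord4;
  rewrite !mxE /= /Defs.lam; ring.
Qed.

Definition grad_N x (i k : 'I_4) : 'I_4 -> R[i] :=
  fun j => grad_K x i k j - grad4 0 (2 * g2 * q2 x) 0 0 j *+ (i == k).

Lemma cderiv_N x i k : cderiv (fun y => N_I1 g2 y i k) x (grad_N x i k).
Proof.
have -> : (fun y => N_I1 g2 y i k) =
    fun y => K_I1 g2 y i k + - ((i == k)%:R * lam y).
  apply/funext => y; rewrite N_I1_sub !mxE.
  by rewrite mulr_natl.
apply: (eq_cderiv (cderivD (cderiv_K x i k)
  (cderivN (cderivZ (i == k)%:R (cderiv_lam x))))) => j.
by rewrite /grad_N mulr_natl.
Qed.

Lemma dmx_K x a b c d : dmx (K_I1 g2) x (col4 a b c d) = mx_of_rows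
  [:: [:: - (g2 * q2 x) * b; 2 * g2 * q2 x * a - g2 * q1 x * b; 0; 0];
      [:: 0; 0; 0; 0];
      [:: 0; g2 * p1 x * b + 2 * g2 * q2 x * c; g2 * q2 x * b; 0];
      [:: - (g2 * q2 x) * c; - (g2 * p1 x) * a - g2 * q1 x * c;
          - (g2 * q2 x) * a; 0]].
Proof.
have pE i k j := (cderiv_K x i k).2 j.
by apply/matrixP; apply: forall_ord4; apply: forall_ord4;
  rewrite mxE sum_ord4 !pE !mxE /grad_K /grad4 /=; ring.
Qed.

Lemma dmx_N x a b c d : dmx (N_I1 g2) x (col4 a b c d) = mx_of_rows
  [:: [:: - (g2 * q2 x) * b; - (g2 * q1 x) * b; 0; 0];
      [:: 0; - (2 * g2 * q2 x) * b; 0; 0];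
      [:: 0; g2 * p1 x * b; g2 * q2 x * b; 0];
      [:: - (g2 * q2 x) * c;
          - (g2 * p1 x) * a - g2 * q1 x * c - 2 * g2 * q2 x * d;
          - (g2 * q2 x) * a; 0]].
Proof.
have pE i k j := (cderiv_N x i k).2 j.
by apply/matrixP; apply: forall_ord4; apply: forall_ord4;
  rewrite mxE sum_ord4 !pE !mxE /grad_N /grad_K /grad4 /= ?mulr0n ?mulr1n; ring.
Qed.

Lemma Nijenhuis_N : Nijenhuis_operator (N_I1 g2).
Proof.
apply: Nijenhuis_operatorP => [x i j|x u v]; first by have [] := cderiv_N x i j.
rewrite [u]col4_eta [v]col4_eta /torsion_at !dmx_N N_I1E.
rewrite !(mul_col4, add_col4, opp_col4) /Defs.lam.
by apply: col4_0; ring.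
Qed.

(** [s] and [t] are the values of dq1 /\ dq2 and dp1 /\ dq2 on the two arguments. Both forms contain
    dq2, which annihilates the image of [K_I1] because its second row is zero. *)
Lemma torsion_K x a b c d a' b' c' d' :
  torsion_at (K_I1 g2) x (col4 a b c d) (col4 a' b' c' d') =
  let s := a * b' - a' * b in let t := c * b' - c' * b in
  let r := 2 * g2 * q2 x in
  col4 (r * lam x * s) 0 (r * lam x * t)
       (- r * g2 * q2 x * (q1 x * t + p1 x * s)).
Proof.
rewrite /torsion_at /K_I1 !(mul_col4, dmx_K, add_col4, opp_col4) /Defs.lam /=.
by congr col4; ring.
Qed.

(** Write T(u,v) = r K w(u,v) with r = 2 g2 q2 and w = (s, 0, t, 0). Then w(Ku,Kv) = 0, w(Ku,v) +
    w(u,Kv) = lam w(u,v) and K^2 = lam K, so the remaining terms r K^3 w and r lam K^2 w cancel. *)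
Lemma Haantjes_K : Haantjes_operator (K_I1 g2).
Proof.
apply: Haantjes_operatorP => [x i j|x u v]; first by have [] := cderiv_K x i j.
rewrite [u]col4_eta [v]col4_eta {1 2 3 5}/K_I1 !mul_col4.
rewrite !torsion_K /= /K_I1 !(mul_col4, add_col4, opp_col4) /Defs.lam.
by apply: col4_0; ring.
Qed.

Lemma wedge_delta (a b : 'cV[R[i]]_4) i j :
  wedge a b (delta_mx j 0) (delta_mx i 0) = a j 0 * b i 0 - a i 0 * b j 0.
Proof.
have E (c : 'cV[R[i]]_4) k : (c^T *m delta_mx k 0) 0 0 = c k 0.
  rewrite mxE sum_ord4 !mxE.
  by move: k; apply: forall_ord4; rewrite /=; ring.
by rewrite /wedge !E.
Qed.

Lemma OmegaE x : Omega x = mx_of_rows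
  [:: [:: 0; 0; -1; 0]; [:: 0; 0; 0; -1]; [:: 1; 0; 0; 0]; [:: 0; 1; 0; 0]].
Proof.
have := ((cderiv_q1 x).2, (cderiv_q2 x).2, ((cderiv_p1 x).2, (cderiv_p2 x).2)).
rewrite /Defs.q1 /Defs.q2 /Defs.p1 /Defs.p2 => -[[dq1 dq2] [dp1 dp2]].
apply/matrixP => i j; rewrite mxE /omega /sum_dQdP sum_ord2.
rewrite !wedge_delta !mxE !dq1 !dq2 !dp1 !dp2.
by move: i j; apply: forall_ord4; apply: forall_ord4; rewrite /grad4 /=; ring.
Qed.

Lemma compatible_K : compatible_omega (K_I1 g2).
Proof.
move=> x; rewrite OmegaE /K_I1 [(mx_of_rows _)^T]mx4_eta !mxE /= !mul_mx4 /=.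
by apply/matrixP; apply: forall_ord4; apply: forall_ord4; rewrite !mxE /=; ring.
Qed.

Lemma chain_K g1 : chain_equation (K_I1 g2) (H2 g1 g2) (I1 g1 g2).
Proof.
move=> x.
have q1x := cderiv_q1 x; have q2x := cderiv_q2 x.
have p1x := cderiv_p1 x; have p2x := cderiv_p2 x.
have qp := cderivD (cderivM q1x p1x) (cderivM q2x p2x).
(* The gradient is left as a hole, which the term built from the differentiation rules fills in. *)
have dH : forall j, partial j (H2 g1 g2) x = _ :=
  (cderivD (cderivD (cderivD (cderivM p1x p1x) (cderivM p2x p2x))
    (cderivZ g1 qp)) (cderivZ g2 (cderivM qp qp))).2.
have dI : forall j, partial j (I1 g1 g2) x = _ :=
  (cderivD (cderivM (cderivD (cderiv_cst 1 x) (cderivZ g2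
    (cderivD (cderivM q1x q1x) (cderivM q2x q2x)))) (cderivM p1x p1x))
    (cderivM (cderivZ g1 q1x) p1x)).2.
rewrite [d _ _]col4_eta [d (I1 _ _) _]col4_eta /d !mxE !dH !dI.
rewrite /K_I1 [(mx_of_rows _)^T]mx4_eta !mxE mul_col4 /grad4 /=.
by apply/colP; apply: forall_ord4; rewrite !mxE /=; ring.
Qed.

End Operator.

(** * The coordinates (Q, P) *)

Section Coordinates.
Context {R : realType}.
Variable g2 : R[i].
Hypothesis g2_axis : real_or_imaginary g2.
Implicit Types (x y : phase R).
Local Notation q1 := (@q1 R). Local Notation q2 := (@q2 R).
Local Notation p1 := (@p1 R). Local Notation p2 := (@p2 R).
Local Notation lam := (lam g2).
Local Notation Re := complex.Re.
Local Notation Im := complex.Im.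

Definition rt x := sqrtc (lam x).

Lemma rt_neq0 x : dom g2 x -> rt x != 0.
Proof. by rewrite /rt sqrtc_eq0. Qed.

Lemma rt_sqr x : rt x * rt x = lam x.
Proof. by rewrite -expr2 sqr_sqrtc. Qed.

Lemma lamV x : (lam x)^-1 = (rt x)^-1 * (rt x)^-1.
Proof. by rewrite -rt_sqr invfM. Qed.

Lemma open_dom : open (dom g2).
Proof.
rewrite openE => x xd; apply: cdiff_near_neq0 => //.
by have [] := cderiv_lam g2 x.
Qed.

Lemma Re_lam x : Re (lam x) = 1 + Re g2 * x 0 (qidx 1) ^+ 2.
Proof.
rewrite /Defs.lam /Defs.q2 /q complexReD complexReM expr2 complexReM complexImM.
by rewrite /=; ring.
Qed.

Lemma Im_lam x : Im (lam x) = Im g2 * x 0 (qidx 1) ^+ 2.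
Proof.
rewrite /Defs.lam /Defs.q2 /q complexImD complexImM expr2 complexReM complexImM.
by rewrite /=; ring.
Qed.

Lemma cdiff_rt x : dom g2 x -> cdiff rt x.
Proof.
move=> xd; have [dl _] := cderiv_lam g2 x.
case: g2_axis => [im0|re0]; last first.
  apply: cdiff_sqrtc_slit_plane => //; near=> y.
  by rewrite /slit_plane Re_lam re0 mul0r addr0 ltr01 orbT.
have il y : Im (lam y) = 0 by rewrite Im_lam im0 mul0r.
have cl := differentiable_continuous dl.1.
have := xd; rewrite /dom /= complex_neq0 il eqxx orbF.
(* [lam] is real and nonzero at [x], so by continuity it keeps its sign near [x]; the negative case
   is the one on the branch cut. *)
case: ltrgtP => // rl _.
  have H : nbhs (Re (lam x)) [set r | r < 0].
    by apply: open_nbhs_nbhs; split=> //; exact: open_lt.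
  have : \forall y \near x, Re (lam y) < 0 by exact: cl _ H.
  move=> H'; apply: cdiff_sqrtc_neg => //; near=> y; split=> //.
  by near: y.
have H : nbhs (Re (lam x)) [set r | 0 < r].
  by apply: open_nbhs_nbhs; split=> //; exact: open_gt.
have : \forall y \near x, 0 < Re (lam y) by exact: cl _ H.
move=> H'; apply: cdiff_sqrtc_slit_plane => //; near=> y.
rewrite /slit_plane il eqxx /=; near: y; exact: H'.
Unshelve. all: by end_near. Qed.

Lemma cderiv_rt x : dom g2 x ->
  cderiv rt x (grad4 0 (g2 * q2 x / rt x) 0 0).
Proof.
move=> xd; have s0 := rt_neq0 xd.
apply: (eq_cderiv (cderiv_sqrtc xd (cderiv_lam g2 x) (cdiff_rt xd))).
by apply: forall_ord4; rewrite /grad4 /= -?/(rt x); field.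
Qed.

Lemma cderiv_rtV x : dom g2 x ->
  cderiv (fun y => (rt y)^-1) x (grad4 0 (- (g2 * q2 x * (rt x)^-1 ^+ 3)) 0 0).
Proof.
move=> xd; have s0 := rt_neq0 xd.
apply: (eq_cderiv (cderivV s0 (cderiv_rt xd))).
by apply: forall_ord4; rewrite /grad4 /=; field.
Qed.

(** Replacing 1 / lam by the square of 1 / rt puts [P2] in the algebra [coord_alg] and lets
    [cderiv_rtV] differentiate it. *)
Lemma P2E y :
  P2 g2 y = p2 y + g2 * q1 y * q2 y * p1 y * ((rt y)^-1 * (rt y)^-1).
Proof. by rewrite /P2 lamV. Qed.

(* The algebra generated by the coordinates, rt and 1 / rt is closed under
   partial derivatives on dom and contains the components of (Q, P). *)
Inductive coord_alg : (phase R -> R[i]) -> Prop :=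
| coord_alg_cst c : coord_alg (fun=> c)
| coord_alg_coord k : coord_alg (fun y => (y 0 k)%:C%C)
| coord_alg_rt : coord_alg rt
| coord_alg_rtV : coord_alg (fun y => (rt y)^-1)
| coord_algD f g : coord_alg f -> coord_alg g -> coord_alg (fun y => f y + g y)
| coord_algM f g : coord_alg f -> coord_alg g -> coord_alg (fun y => f y * g y).

Lemma coord_alg_smooth f : coord_alg f -> smooth_on (dom g2) f.
Proof.
apply: smooth_on_coind f; first exact: open_dom.
have q2a : coord_alg q2 by exact: coord_alg_coord.
move=> f; elim=> {f} [c|k|||f g Cf [D [CD fD]] Cg [D' [CD' gD']]
                         |f g Cf [D [CD fD]] Cg [D' [CD' gD']]].
- exists (fun _ _ => 0); split=> [j|x _]; first exact: coord_alg_cst.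
  exact: cderiv_cst.
- exists (fun j _ => (j == k)%:R); split=> [j|x _]; first exact: coord_alg_cst.
  exact: cderiv_coord.
(* Index 1 is the [q2] direction, the only one along which [lam] varies. *)
- exists (fun j x => (j == 1)%:R * g2 * (q2 x * (rt x)^-1)); split=> [j|x xd].
    apply: coord_algM; first exact: coord_alg_cst.
    by apply: coord_algM => //; exact: coord_alg_rtV.
  apply: (eq_cderiv (cderiv_rt xd)).
  by apply: forall_ord4; rewrite /grad4 /= ?mul0r // !mul1r !mulrA.
- exists (fun j x => - (j == 1)%:R * g2 *
    (q2 x * ((rt x)^-1 * ((rt x)^-1 * (rt x)^-1)))); split=> [j|x xd].
    apply: coord_algM; first exact: coord_alg_cst.
    apply: coord_algM => //.
    by do 2?apply: coord_algM; exact: coord_alg_rtV.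
  apply: (eq_cderiv (cderiv_rtV xd)).
  by apply: forall_ord4; rewrite /grad4 /=; ring.
- exists (fun j x => D j x + D' j x); split=> [j|x xd]; first exact: coord_algD.
  exact: cderivD (fD x xd) (gD' x xd).
- exists (fun j x => D j x * g x + f x * D' j x); split=> [j|x xd].
    by apply: coord_algD; exact: coord_algM.
  exact: cderivM (fD x xd) (gD' x xd).
Qed.

Lemma forall_ord2 (P : 'I_2 -> Prop) : P 0 -> P 1 -> forall i, P i.
Proof.
by move=> P0 P1 [[|[|//]] i2]; [move: P0|move: P1]; congr P; exact: val_inj.
Qed.

Lemma componentsE (Q P : 'I_2 -> phase R -> R[i]) :
  [/\ components Q P 0 = Q 0, components Q P 1 = Q 1,
      components Q P 2%:R = P 0 & components Q P 3%:R = P 1].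
Proof.
have lE i : components Q P (qidx i) = Q i.
  by rewrite /components (@unsplitK 2 2 (inl i)).
have rE i : components Q P (pidx i) = P i.
  by rewrite /components (@unsplitK 2 2 (inr i)).
by split; rewrite -?lE -?rE; congr (components Q P _); exact: val_inj.
Qed.

Lemma coord_alg_components a : coord_alg (components (Qs g2) (Ps g2) a).
Proof.
have [c0 c1 c2 c3] := componentsE (Qs g2) (Ps g2).
have cc := coord_alg_coord.
move: a; apply: forall_ord4; rewrite ?c0 ?c1 ?c2 ?c3.
- by apply: coord_algM; [exact: cc|exact: coord_alg_rtV].
- exact: cc.
- by apply: coord_algM; [exact: cc|exact: coord_alg_rt].
- rewrite (_ : Ps g2 1 = fun y =>
      p2 y + g2 * q1 y * q2 y * p1 y * ((rt y)^-1 * (rt y)^-1)); last first.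
    by apply/funext => y; exact: P2E.
  apply: coord_algD; first exact: cc.
  apply: coord_algM; last by apply: coord_algM; exact: coord_alg_rtV.
  apply: coord_algM; last exact: cc.
  apply: coord_algM; last exact: cc.
  by apply: coord_algM; [exact: coord_alg_cst|exact: cc].
Qed.

Definition gradQ x (i : 'I_2) : 'I_4 -> R[i] :=
  if i == 0 then
    grad4 (rt x)^-1 (- (g2 * q1 x * q2 x * (rt x)^-1 ^+ 3)) 0 0
  else grad4 0 1 0 0.

Definition gradP x (i : 'I_2) : 'I_4 -> R[i] :=
  if i == 0 then grad4 0 (g2 * p1 x * q2 x * (rt x)^-1) (rt x) 0
  else grad4 (g2 * q2 x * p1 x * (rt x)^-1 ^+ 2)
    (g2 * q1 x * p1 x * (rt x)^-1 ^+ 2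
     - 2 * g2 ^+ 2 * q1 x * q2 x ^+ 2 * p1 x * (rt x)^-1 ^+ 4)
    (g2 * q1 x * q2 x * (rt x)^-1 ^+ 2) 1.

Lemma cderiv_Qs x i : dom g2 x -> cderiv (Qs g2 i) x (gradQ x i).
Proof.
move=> xd; move: i; apply: forall_ord2; last exact: cderiv_q2.
apply: (eq_cderiv (cderivM (cderiv_q1 x) (cderiv_rtV xd))).
by apply: forall_ord4; rewrite /gradQ /grad4 /=; ring.
Qed.

Lemma cderiv_Ps x i : dom g2 x -> cderiv (Ps g2 i) x (gradP x i).
Proof.
move=> xd; move: i; apply: forall_ord2.
  apply: (eq_cderiv (cderivM (cderiv_p1 x) (cderiv_rt xd))).
  by apply: forall_ord4; rewrite /gradP /grad4 /=; ring.
rewrite (_ : Ps g2 1 = fun y =>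
    p2 y + g2 * q1 y * q2 y * p1 y * ((rt y)^-1 * (rt y)^-1)); last first.
  by apply/funext => y; exact: P2E.
have v := cderiv_rtV xd.
apply: (eq_cderiv (cderivD (cderiv_p2 x) (cderivM (cderivM (cderivM
  (cderivZ g2 (cderiv_q1 x)) (cderiv_q2 x)) (cderiv_p1 x)) (cderivM v v)))).
by apply: forall_ord4; rewrite /gradP /grad4 /=; ring.
Qed.

Lemma canonical_QP : canonical_on (dom g2) (Qs g2) (Ps g2).
Proof.
move=> x xd i j; have s0 := rt_neq0 xd.
have pQ k l : partial l (Qs g2 k) x = gradQ x k l := (cderiv_Qs k xd).2 l.
have pP k l : partial l (Ps g2 k) x = gradP x k l := (cderiv_Ps k xd).2 l.
rewrite /poisson !sum_ord2 !pQ !pP.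
by move: i j; apply: forall_ord2; apply: forall_ord2;
  rewrite /gradQ /gradP /grad4 /=; split; field.
Qed.

Lemma d_grad4 f x a b c e :
  cderiv f x (grad4 a b c e) -> d f x = col4 a b c e.
Proof. by move=> [_ fD]; apply/colP => j; rewrite !mxE fD. Qed.

Lemma omega_QP x : dom g2 x ->
  forall X Y, omega x X Y = sum_dQdP (Qs g2) (Ps g2) x X Y.
Proof.
move=> xd X Y; have s0 := rt_neq0 xd.
rewrite /omega /sum_dQdP !sum_ord2.
rewrite (d_grad4 (cderiv_Qs 0 xd)) (d_grad4 (cderiv_Qs 1 xd)).
rewrite (d_grad4 (cderiv_Ps 0 xd)) (d_grad4 (cderiv_Ps 1 xd)).
(* Q2 is q2: [d (q 1) x] has been rewritten together with [d (Qs g2 1) x]. *)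
rewrite (d_grad4 (cderiv_q1 x : cderiv (q 0) x _)).
rewrite (d_grad4 (cderiv_p1 x : cderiv (p 0) x _)).
rewrite (d_grad4 (cderiv_p2 x : cderiv (p 1) x _)).
rewrite /wedge !dot_col4; field; exact: s0.
Qed.

Lemma coord_jacobianE x : dom g2 x -> coord_jacobian (Qs g2) (Ps g2) x =
  mx_of_rows
  [:: [:: gradQ x 0 0; gradQ x 0 1; gradQ x 0 2%:R; gradQ x 0 3%:R];
      [:: gradQ x 1 0; gradQ x 1 1; gradQ x 1 2%:R; gradQ x 1 3%:R];
      [:: gradP x 0 0; gradP x 0 1; gradP x 0 2%:R; gradP x 0 3%:R];
      [:: gradP x 1 0; gradP x 1 1; gradP x 1 2%:R; gradP x 1 3%:R]].
Proof.
move=> xd; have [c0 c1 c2 c3] := componentsE (Qs g2) (Ps g2).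
have pQ k l : partial l (Qs g2 k) x = gradQ x k l := (cderiv_Qs k xd).2 l.
have pP k l : partial l (Ps g2 k) x = gradP x k l := (cderiv_Ps k xd).2 l.
by rewrite [LHS]mx4_eta !mxE c0 c1 c2 c3 !pQ !pP.
Qed.

(* For the symplectic J = [A, B; C, E], the inverse is
   [E^T, - B^T; - C^T, A^T]. *)
Lemma coord_jacobian_unit x : dom g2 x ->
  coord_jacobian (Qs g2) (Ps g2) x \in unitmx.
Proof.
move=> xd; have s0 := rt_neq0 xd; rewrite coord_jacobianE //.
pose Q i j := gradQ x i j; pose P i j := gradP x i j.
pose J' := mx_of_rows
  [:: [:: P 0 2%:R; P 1 2%:R; - Q 0 2%:R; - Q 1 2%:R];
      [:: P 0 3%:R; P 1 3%:R; - Q 0 3%:R; - Q 1 3%:R];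
      [:: - P 0 0; - P 1 0; Q 0 0; Q 1 0];
      [:: - P 0 1; - P 1 1; Q 0 1; Q 1 1]].
apply: (mulmx1_unit (B := J') _).1.
rewrite mul_mx4 /Q /P /gradQ /gradP /grad4 /=.
by apply/matrixP; apply: forall_ord4; apply: forall_ord4; rewrite !mxE /=;
  field.
Qed.

Definition diagK x : 'M[R[i]]_4 := mx_of_rows
  [:: [:: lam x; 0; 0; 0]; [:: 0; 0; 0; 0]; [:: 0; 0; lam x; 0];
      [:: 0; 0; 0; 0]].

Lemma coord_jacobian_K x : dom g2 x ->
  coord_jacobian (Qs g2) (Ps g2) x *m K_I1 g2 x =
  diagK x *m coord_jacobian (Qs g2) (Ps g2) x.
Proof.
move=> xd; have s0 := rt_neq0 xd; rewrite coord_jacobianE //.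
(* With [lam] written as [rt * rt], the relation is a rational identity in which [rt] may be treated
   as an independent nonzero quantity. *)
rewrite /K_I1 -/(lam x) /diagK !mul_mx4 -rt_sqr /gradQ /gradP /grad4 /=.
by apply/matrixP; apply: forall_ord4; apply: forall_ord4; rewrite !mxE /=;
  field.
Qed.

(** The change of coordinates is triangular: [Q2] is [q2] and fixes [rt]; then [Q1] and [P1] give
    [q1] and [p1]; finally [P2] gives [p2]. *)
Lemma QP_inj x y : dom g2 x -> dom g2 y ->
  (forall a, components (Qs g2) (Ps g2) a x = components (Qs g2) (Ps g2) a y) ->
  x = y.
Proof.
move=> xd yd E; have [c0 c1 c2 c3] := componentsE (Qs g2) (Ps g2).
have := (E 0, E 1, (E 2%:R, E 3%:R)); rewrite c0 c1 c2 c3.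
rewrite /Qs /Ps /= => -[[E0 E1] [E2 E3]].
have q2E : q2 x = q2 y by exact: E1.
have lE : lam x = lam y by rewrite /Defs.lam q2E.
have sE : rt x = rt y by rewrite /rt lE.
have s0 := rt_neq0 yd.
have q1E : q1 x = q1 y.
  by move: E0; rewrite /Q1 -!/(rt _) sE => /mulIf; apply; rewrite invr_eq0.
have p1E : p1 x = p1 y by move: E2; rewrite /P1 -!/(rt _) sE => /mulIf; apply.
have p2E : p2 x = p2 y.
  by move: E3; rewrite /P2 lE q1E q2E p1E => /addIr.
apply/rowP; apply: forall_ord4.
- by case: q1E => e; rewrite (_ : 0 = qidx 0) //; exact: val_inj.
- by case: q2E => e; rewrite (_ : 1 = qidx 1) //; exact: val_inj.
- by case: p1E => e; rewrite (_ : 2%:R = pidx 0) //; exact: val_inj.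
- by case: p2E => e; rewrite (_ : 3%:R = pidx 1) //; exact: val_inj.
Qed.

Lemma Darboux_Haantjes_QP :
  Darboux_Haantjes_on (dom g2) (K_I1 g2) (Qs g2) (Ps g2).
Proof.
split; [split|exact: omega_QP|] => [a|x y|x|x] xd.
- exact/coord_alg_smooth/coord_alg_components.
- exact: QP_inj.
- exact: coord_jacobian_unit.
- rewrite coord_jacobian_K // -mulmxA mulmxV ?mulmx1; last first.
    exact: coord_jacobian_unit.
  by apply/is_diag_mxP; apply: forall_ord4; apply: forall_ord4; rewrite mxE.
Qed.

End Coordinates.

(** * Spectrum and limits *)

Lemma mxrank_scalar {F : fieldType} n (a : F) : a != 0 ->
  \rank (a%:M : 'M[F]_n) = n.
Proof. by move=> a0; rewrite -scalemx1 mxrank_scale_nz // mxrank1. Qed.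

Section Spectrum.
Context {R : realType}.
Variable g2 : R[i].
Implicit Types (x : phase R) (a : R[i]).
Local Notation lam := (lam g2).

(** The row of index 1 of [K_I1] vanishes, so expansion along it leaves a factor X times one minor.
    That minor is lower triangular with diagonal X - lam, X - lam, X. *)
Lemma char_poly_K x :
  char_poly (K_I1 g2 x) = ('X - 0%:P) ^+ 2 * ('X - (lam x)%:P) ^+ 2.
Proof.
rewrite /char_poly (expand_det_row _ 1) (bigD1 (1 : 'I_4)) //= big1 ?addr0.
  rewrite /cofactor det_trig.
    rewrite !big_ord_recl big_ord0 !mxE /= ?mulr0n ?mulr1n ?polyC0.
    rewrite -/(lam x) expr2 expr2 -signr_odd /= expr0.
    by ring.
  apply/is_trig_mxP => -[[|[|[|//]]] i3] [[|[|[|//]]] j3] //= _;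
    by rewrite !mxE /= ?mulr0n ?polyC0 ?subr0.
move=> j j1; rewrite !mxE eq_sym (negPf j1) mulr0n.
move: j j1; apply: forall_ord4 => // _;
  by rewrite /= polyC0 subr0 mul0r.
Qed.

Lemma eigenvalue_K x a :
  eigenvalue (K_I1 g2 x) a <-> a = lam x \/ a = 0.
Proof.
rewrite eigenvalue_root_char char_poly_K rootM !root_exp_XsubC.
by split=> [/orP[]/eqP->|[]->]; [right|left|rewrite eqxx orbT|rewrite eqxx].
Qed.

(** Half the trace of [K_I1] is [lam], so [N_I1] has the same eigenvectors as [K_I1] and its
    spectrum is shifted by - lam. *)
Lemma eigenvalue_N x a :
  eigenvalue (N_I1 g2 x) a <-> a = 0 \/ a = - lam x.
Proof.
have E : eigenvalue (N_I1 g2 x) a <-> eigenvalue (K_I1 g2 x) (a + lam x).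
  rewrite N_I1_sub.
  split=> /eigenvalueP[v vE v0]; apply/eigenvalueP; exists v => //.
    rewrite [RHS]scalerDl -vE.
    by rewrite mulmxBr mul_mx_scalar subrK.
  by rewrite mulmxBr mul_mx_scalar vE [X in X - _]scalerDl addrK.
rewrite E eigenvalue_K; split=> -[h|h].
- by left; apply: (addIr (lam x)); rewrite h add0r.
- by right; apply/eqP; rewrite -addr_eq0 h.
- by left; rewrite h add0r.
- by right; rewrite h addNr.
Qed.

(** Membership in [dom] keeps the two roots apart; at lam = 0 they would merge into one root of
    multiplicity 4. *)
Lemma alg_mult_K x : dom g2 x ->
  alg_mult (K_I1 g2 x) (lam x) = 2%N /\ alg_mult (K_I1 g2 x) 0 = 2%N.
Proof.
move=> xd; have X0 c : ('X - c%:P : {poly R[i]}) ^+ 2 != 0.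
  by rewrite expf_neq0 ?polyXsubC_eq0.
rewrite /alg_mult char_poly_K; split; rewrite mupM ?X0 // !mup_XsubCX eqxx.
  by rewrite eq_sym (negPf xd).
by rewrite (negPf xd).
Qed.

(** Such a matrix factors through dimension 2: [U e c *m V e] carries [c] at the diagonal positions
    of parity [e] and is zero elsewhere. *)
Lemma rank_diag4_le (a b : R[i]) : a = 0 \/ b = 0 ->
  (\rank (mx_of_rows [:: [:: a; 0; 0; 0]; [:: 0; b; 0; 0]; [:: 0; 0; a; 0];
                         [:: 0; 0; 0; b]])%R <= 2)%N.
Proof.
pose U (e : bool) (c : R[i]) : 'M[R[i]]_(4, 2) :=
  \matrix_(i, k) (c *+ (i == e + k.*2 :> nat)%N).
pose V (e : bool) : 'M[R[i]]_(2, 4) :=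
  \matrix_(k, j) (j == e + k.*2 :> nat)%N%:R.
have UV e c : (\rank (U e c *m V e) <= 2)%N.
  exact: leq_trans (mxrankM_maxr _ _) (rank_leq_row _).
case=> ->; [have := UV true b|have := UV false a];
  congr (\rank _ <= 2)%N; apply/matrixP; apply: forall_ord4; apply: forall_ord4;
  by rewrite !mxE sum_ord2 !mxE /=; ring.
Qed.

(* The two ranks add up to at least 4 and neither exceeds 2. *)
Lemma rank_diagK x a : dom g2 x -> a = lam x \/ a = 0 ->
  \rank (diagK g2 x - a%:M)%R = 2%N.
Proof.
move=> xd ax.
have r0 : (\rank (diagK g2 x) <= 2)%N by apply: rank_diag4_le; right.
have DE : diagK g2 x - (lam x)%:M = mx_of_rows
  [:: [:: 0; 0; 0; 0]; [:: 0; - lam x; 0; 0]; [:: 0; 0; 0; 0];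
      [:: 0; 0; 0; - lam x]].
  apply/matrixP; apply: forall_ord4; apply: forall_ord4;
  by rewrite !mxE /= ?mulr0n ?mulr1n; ring.
have r1 : (\rank (diagK g2 x - (lam x)%:M)%R <= 2)%N.
  by rewrite DE; apply: rank_diag4_le; left.
have : (4 <= \rank (diagK g2 x) + \rank (diagK g2 x - (lam x)%:M)%R)%N.
  rewrite -{1}(mxrank_scalar 4 xd) -[X in \rank X](subKr (diagK g2 x)).
  by apply: leq_trans (mxrank_add _ _) _; rewrite mxrank_opp.
move: r0 r1; case: ax => ->; rewrite ?raddf0 ?oppr0 ?addr0.
  by move: (\rank _) => m; move: (\rank _) => n; lia.
by move: (\rank _) => m; move: (\rank _) => n; lia.
Qed.

(** By rank-nullity the multiplicity is 4 minus the rank of K - a. Conjugation by the invertible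
    Jacobian replaces [K_I1] by [diagK], for which that rank is 2. *)
Lemma geo_mult_K x a : real_or_imaginary g2 -> dom g2 x ->
  a = lam x \/ a = 0 -> geo_mult (K_I1 g2 x) a = 2%N.
Proof.
move=> g2a xd ax.
have := coord_jacobian_K g2a xd; have := coord_jacobian_unit g2a xd.
move: (coord_jacobian _ _ x) => J Ju JK.
have JKa : J *m (K_I1 g2 x - a%:M) = (diagK g2 x - a%:M) *m J.
  by rewrite mulmxBr JK scalar_mxC mulmxBl.
rewrite /geo_mult /eigenspace mxrank_ker.
have -> : (K_I1 g2 x)^T - a%:M = (K_I1 g2 x - a%:M)^T.
  by rewrite linearB /= tr_scalar_mx.
rewrite mxrank_tr -(eqmxMfull (K_I1 g2 x - a%:M) (A := J)) ?row_full_unit //.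
by rewrite JKa mxrankMfree ?row_free_unit // rank_diagK.
Qed.

Lemma semisimple_K x : real_or_imaginary g2 -> dom g2 x ->
  semisimple (K_I1 g2 x).
Proof.
move=> g2a xd a /eigenvalue_K ax; rewrite geo_mult_K //.
by have [e1 e2] := alg_mult_K xd; case: ax => ->.
Qed.

End Spectrum.

(* Stated over K^o, since R[i] itself carries no canonical topology. *)
Section NumFieldLimits.
Context {K : numFieldType} {T : Type} {F : set_system T} {FF : Filter F}.
Implicit Types (a c : K) (f h : T -> K^o).

Lemma cvg_scale1 c f : f t @[t --> F] --> (1 : K^o) ->
  (c * f t : K^o) @[t --> F] --> (c : K^o).
Proof. by move=> /(@cvgM K T F FF _ _ _ _ (cvg_cst c)); rewrite mulr1. Qed.

Lemma cvg_inv1 f : f t @[t --> F] --> (1 : K^o) ->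
  ((f t)^-1 : K^o) @[t --> F] --> (1 : K^o).
Proof. by move=> /(@cvgV K T F FF _ _ (oner_neq0 _)); rewrite invr1. Qed.

(** The common shape of [lam] and [P2] as functions of the parameter: a constant plus a multiple of
    the parameter times a factor tending to 1. *)
Lemma cvg_perturb a c h f : h t @[t --> F] --> (0 : K^o) ->
  f t @[t --> F] --> (1 : K^o) ->
  (a + c * h t * f t : K^o) @[t --> F] --> (a : K^o).
Proof.
move=> h0 f1; have ch0 := @cvgM K T F FF _ _ _ _ (cvg_cst c) h0.
have chf0 := @cvgM K T F FF _ _ _ _ (ch0 FF) f1.
have := @cvgD K K^o T F FF _ _ _ _ (cvg_cst a) chf0.
by rewrite mulr0 mul0r addr0; apply.
Qed.

End NumFieldLimits.

(** * Reality and limits of the coordinates, and the two integrals expressed in them *)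

Section Limits.
Context {R : realType}.
Implicit Types (x : phase R) (g : R[i]).

Lemma real_complexE (z : R[i]) : (z \is Num.real) = (complex.Im z == 0).
Proof. by case: z => a b; rewrite complex_real. Qed.

(** For lam > 0 the principal root is an ordinary real root, and the coordinates arise from real
    numbers by field operations. On this region they form a chart in the usual real sense. *)
Lemma real_QP (g2 : R[i]) x i : complex.Im g2 = 0 -> 0 < lam g2 x ->
  complex.Im (Qs g2 i x) = 0 /\ complex.Im (Ps g2 i x) = 0.
Proof.
move=> g20 l0.
have g2r : g2 \is Num.real by rewrite real_complexE; apply/eqP.
have cr (t : R) : (t%:C)%C \is Num.real by rewrite real_complexE.
have sr : sqrtc (lam g2 x) \is Num.real.
  by rewrite sqrtc_sqrtr ?ltW // cr.
have lr : lam g2 x \is Num.real by rewrite gtr0_real.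
have [q1r q2r p1r p2r] :
    [/\ q1 x \is Num.real, q2 x \is Num.real, p1 x \is Num.real
      & p2 x \is Num.real] by split; exact: cr.
suff [Qr Pr] : Qs g2 i x \is Num.real /\ Ps g2 i x \is Num.real.
  by split; apply/eqP; rewrite -real_complexE.
move: i; apply: forall_ord2; rewrite /Qs /Ps /=; split=> //.
- by rewrite rpredM ?rpredV.
- by rewrite rpredM.
- by rewrite rpredD // rpredM ?rpredV // !rpredM.
Qed.

(** With s = sqrtc z one has z - 1 = (s - 1)(s + 1), and |s + 1| >= Re (s + 1) >= 1 since the
    principal root has nonnegative real part. This yields continuity of [sqrtc] at 1. *)
Lemma sqrtc_sub1_le (z : R[i]) : `|sqrtc z - 1| <= `|z - 1|.
Proof.
have zE : z - 1 = (sqrtc z - 1) * (sqrtc z + 1).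
  by rewrite -[z in LHS]sqr_sqrtc; ring.
rewrite zE normrM ler_peMr // (le_trans _ (normc_ge_Re _)) //.
rewrite complexReD Re_sqrtc /= ger0_norm ?addr_ge0 ?sqrtr_ge0 //.
by rewrite -[1]/(1%:C)%C lecR lerDr sqrtr_ge0.
Qed.

Lemma cvg_id0 : (g : R[i]^o) @[g --> (0 : R[i]^o)] --> (0 : R[i]^o).
Proof. exact: cvg_id. Qed.

Lemma cvg_lam x : (lam g x : R[i]^o) @[g --> (0 : R[i]^o)] --> (1 : R[i]^o).
Proof.
have E : (fun g : R[i]^o => lam g x) =
    (* The trailing factor 1 supplies the function tending to 1 in [cvg_perturb]. *)
    fun g : R[i]^o => 1 + q2 x ^+ 2 * (g : R[i]) * 1.
  by apply/funext => g; rewrite /lam mulr1 mulrC.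
rewrite E; exact: cvg_perturb cvg_id0 (cvg_cst _).
Qed.

Lemma cvg_sqrtc_lam x :
  (sqrtc (lam g x) : R[i]^o) @[g --> (0 : R[i]^o)] --> (1 : R[i]^o).
Proof.
have F : Filter (nbhs (0 : R[i]^o)) := nbhs_filter _.
apply/(@cvgrPdist_le _ _ _ _ F) => e e0.
have /(@cvgrPdist_le _ _ _ _ F)/(_ e e0) := cvg_lam x.
apply: (@filterS _ _ F) => g.
rewrite distrC [X in _ -> X <= _]distrC.
exact: le_trans (sqrtc_sub1_le _).
Qed.

Lemma cvg_QP x i :
  ((Qs g i x : R[i]^o) @[g --> (0 : R[i]^o)] --> (q i x : R[i]^o)) /\
  ((Ps g i x : R[i]^o) @[g --> (0 : R[i]^o)] --> (p i x : R[i]^o)).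
Proof.
move: i; apply: forall_ord2; rewrite /Qs /Ps /=; split.
- exact: cvg_scale1 (cvg_inv1 (cvg_sqrtc_lam x)).
- exact: cvg_scale1 (cvg_sqrtc_lam x).
- exact: (@cvg_cst _ (_ : R[i]^o) _ _ (nbhs_filter (0 : R[i]^o))).
- have E : (fun g : R[i]^o => P2 g x) = fun g : R[i]^o =>
      p2 x + q1 x * q2 x * p1 x * (g : R[i]) * (lam g x)^-1.
    by apply/funext => g; rewrite /P2; congr (_ + _ / _); ring.
  rewrite E; exact: cvg_perturb cvg_id0 (cvg_inv1 (cvg_lam x)).
Qed.

(** A limit over all complex parameters restricts to any set [D]; it is applied to the union of the
    real and imaginary axes. *)
Lemma cvg_QP_within (D : set R[i]^o) x i :
  ((Qs g i x : R[i]^o) @[g --> within D (nbhs (0 : R[i]^o))]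
     --> (q i x : R[i]^o)) /\
  ((Ps g i x : R[i]^o) @[g --> within D (nbhs (0 : R[i]^o))]
     --> (p i x : R[i]^o)).
Proof.
have [cQ cP] := cvg_QP x i.
split.
  exact: (cvg_trans (cvg_app _ (cvg_within (F := nbhs (0 : R[i]^o)) D)) cQ).
exact: (cvg_trans (cvg_app _ (cvg_within (F := nbhs (0 : R[i]^o)) D)) cP).
Qed.

(** The roots cancel in Q1 P1 = q1 p1, while P1^2 = lam p1^2 absorbs the term g2 q2^2 p1^2 of
    [I1]. *)
Lemma I1_QP (g1 g2 : R[i]) x : dom g2 x ->
  I1 g1 g2 x = P1 g2 x ^+ 2 + g1 * Q1 g2 x * P1 g2 x
               + g2 * (Q1 g2 x * P1 g2 x) ^+ 2.
Proof.
move=> xd; have s0 := rt_neq0 xd.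
have QP : Q1 g2 x * P1 g2 x = q1 x * p1 x.
  by rewrite /Q1 /P1 -/(rt g2 x); field.
rewrite -[g1 * _ * _]mulrA QP {1}/P1 exprMn sqr_sqrtc /I1 /lam; ring.
Qed.

(** Expressed through [I1], the right side involves [lam] but not its root, so this is a rational
    identity in the original variables with [lam] invertible. *)
Lemma H2_QP (g1 g2 : R[i]) x : dom g2 x ->
  H2 g1 g2 x = I1 g1 g2 x / (1 + g2 * Q2 x ^+ 2)
               + P2 g2 x ^+ 2 + g1 * Q2 x * P2 g2 x
               + g2 * (Q2 x * P2 g2 x) ^+ 2.
Proof. by move=> xd; rewrite /H2 /I1 /P2 /Q2 /lam; field; exact: xd. Qed.

End Limits.

Theorem mainTheorem5 (R : realType) (g1 g2 : R[i])
    (hg1 : real_or_imaginary g1) (hg2 : real_or_imaginary g2) :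
  (* 1 *)
  ([/\ Haantjes_operator (K_I1 g2),
       compatible_omega (K_I1 g2),
       chain_equation (K_I1 g2) (H2 g1 g2) (I1 g1 g2)
     & forall x, dom g2 x -> semisimple (K_I1 g2 x)] /\
   (forall x a, eigenvalue (K_I1 g2 x) a <->
      a = 1 + g2 * q2 x ^+ 2 \/ a = 0) /\
   (forall x, dom g2 x ->
      alg_mult (K_I1 g2 x) (1 + g2 * q2 x ^+ 2) = 2%N /\
      alg_mult (K_I1 g2 x) 0 = 2%N) /\
   Nijenhuis_operator (N_I1 g2) /\
   (forall x a, eigenvalue (N_I1 g2 x) a <->
      a = 0 \/ a = - (1 + g2 * q2 x ^+ 2))) /\
  (* 2 *)
  (Darboux_Haantjes_on (dom g2) (K_I1 g2) (Qs g2) (Ps g2) /\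
   (complex.Im g2 = 0 -> forall x, 0 < lam g2 x -> forall i,
      complex.Im (Qs g2 i x) = 0 /\ complex.Im (Ps g2 i x) = 0) /\
   canonical_on (dom g2) (Qs g2) (Ps g2) /\
   (forall x i,
      ((Qs g i x : R[i]^o) @[g --> within [set g | real_or_imaginary g]
         (nbhs (0 : R[i]^o))] --> (q i x : R[i]^o)) /\
      ((Ps g i x : R[i]^o) @[g --> within [set g | real_or_imaginary g]
         (nbhs (0 : R[i]^o))] --> (p i x : R[i]^o)))) /\
  (* 3 *)
  (forall x, dom g2 x ->
     I1 g1 g2 x = P1 g2 x ^+ 2 + g1 * Q1 g2 x * P1 g2 x
                  + g2 * (Q1 g2 x * P1 g2 x) ^+ 2 /\
     H2 g1 g2 x = (P1 g2 x ^+ 2 + g1 * Q1 g2 x * P1 g2 x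
                   + g2 * (Q1 g2 x * P1 g2 x) ^+ 2)
                    / (1 + g2 * Q2 x ^+ 2)
                  + P2 g2 x ^+ 2 + g1 * Q2 x * P2 g2 x
                  + g2 * (Q2 x * P2 g2 x) ^+ 2).
Proof.
split; [split; [|split; [|split; [|split]]]
      |split; [split; [|split; [|split]]|]].
- split; [exact: Haantjes_K|exact: compatible_K|exact: chain_K|].
  by move=> x; exact: semisimple_K.
- exact: eigenvalue_K.
- exact: alg_mult_K.
- exact: Nijenhuis_N.
- exact: eigenvalue_N.
- exact: Darboux_Haantjes_QP.
- by move=> g20 x l0 i; exact: real_QP.
- exact: canonical_QP.
- by move=> x i; exact: cvg_QP_within.
- move=> x xd; split; first exact: I1_QP.
  by rewrite -I1_QP //; exact: H2_QP.
Qed.
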